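(* Let $\tau>0$, let $d_i\ge 0$ and $\tilde\psi_i>0$ for each operator $i=1,\dots,N$, and let $W:[0,\infty)\to[0,\infty)$ be the Lambert $W$ function. For every $\pi_A\ge 0$ and every $i$, the optimal access intensity, i.e. the unique maximizer over $\lambda_i\ge 0$ of $$d_i\,\pi_A\left(1-e^{-\lambda_i\tau}\right)-\frac{\tilde\psi_i}{2}\lambda_i^2,$$ is $$\lambda_i^*(\pi_A)=\frac1\tau\,W\!\left(\frac{d_i\,\pi_A\,\tau^2}{\tilde\psi_i}\right).$$ The intensity $\lambda_i^*(\pi_A)$ is increasing in $d_i$ and in $\pi_A$, and decreasing in $\tilde\psi_i$ (each in the weak sense). Under full reset upon access, expected aggregate residual terminal demand is $$D_A(\pi_A)=\sum_i d_i\,e^{-\lambda_i^*(\pi_A)\,\tau}.$$ Let $\varphi>0$. If $\sum_i d_i>0$, then the map $\pi_A\mapsto \varphi D_A(\pi_A)$ on $[0,\infty)$ is continuous and strictly decreasing, satisfies $\varphi D_A(0)=\varphi\sum_i d_i>0$, and converges to $0$ as $\pi_A\to\infty$. Hence there exists a unique $\pi_A>0$ solving the fixed-point equation $\pi_A=\varphi\,D_A(\pi_A)$.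
   Context: There are finitely many operators $i=1,\dots,N$. Operator $i$ has expected compliance shortfall $d_i\ge0$ and normalized access-cost parameter $\tilde\psi_i>0$. Over a compliance cycle of length $\tau>0$ the operator chooses an intensity $\lambda_i\ge0$; discretionary market-access opportunities then arrive as a Poisson process with intensity $\lambda_i$, so the probability of at least one access opportunity during the cycle is $1-e^{-\lambda_i\tau}$. Having at least one access opportunity has value $S_i=d_i\pi_A$, where $\pi_A\ge0$ is the surrender-month return premium, taken as given by the operator; the cost of intensity $\lambda_i$ is $\frac{\tilde\psi_i}{2}\lambda_i^2$. The operator maximizes $d_i\pi_A(1-e^{-\lambda_i\tau})-\frac{\tilde\psi_i}{2}\lambda_i^2$ over $\lambda_i\ge 0$. Full reset upon access means: operator $i$'s residual terminal demand is $0$ if at least one access opportunity arrives during the cycle, and $d_i$ if none arrives. Expected aggregate residual terminal demand is the sum over $i$ of the expectations of these residual demands when each operator uses its optimal intensity $\lambda_i^*(\pi_A)$. The Lambert $W$ function on $[0,\infty)$ is the inverse of $y\mapsto y e^y$ on $[0,\infty)$. The parameter $\varphi>0$ is the surrender-window return-impact parameter. *)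

(* Defs.v *)
From HB Require Import structures.
From mathcomp Require Import all_boot all_order all_algebra.
From mathcomp Require Import all_classical all_reals all_analysis.

Set Implicit Arguments.
Unset Strict Implicit.
Unset Printing Implicit Defensive.

Import Order.TTheory GRing.Theory Num.Theory.
Import numFieldNormedType.Exports.

Local Open Scope classical_set_scope.
Local Open Scope ring_scope.

(* The library's inverse of y |-> y * exp y restricted to [0, +oo); its value
   is only meaningful on the image of [0, +oo). *)
Definition lambertW {R : realType} : R -> R :=
  'pinv_(fun=> 0) [set y : R | 0 <= y] (fun y => y * expR y).

Definition access_payoff {R : realType} (tau d psi piA lam : R) : R :=
  d * piA * (1 - expR (- (lam * tau))) - psi / 2 * lam ^+ 2.

Definition is_optimal_intensity {R : realType} (tau d psi piA lam : R) : Prop :=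
  0 <= lam /\
  forall mu : R, 0 <= mu ->
    access_payoff tau d psi piA mu <= access_payoff tau d psi piA lam.

(* [get _ | _] chooses a maximizer, and is a default value if there is none. *)
Definition optimal_intensity {R : realType} (tau d psi piA : R) : R :=
  [get lam : R | is_optimal_intensity tau d psi piA lam].

Definition access_demand {R : realType} (N : nat) (tau : R) (d psi : 'I_N -> R)
    (piA : R) : R :=
  \sum_(i < N) d i * expR (- (optimal_intensity tau (d i) (psi i) piA * tau)).

(* X t w is the number of arrivals in (0, t] for the outcome w; only times
   t >= 0 matter. The truncated subtractions are genuine ones, since paths
   are nondecreasing. The second argument of poisson_prob is a dummy, and
   poisson_prob 0 _ is the Dirac measure at 0, so that rate = 0 is allowed. *)
Record poisson_process {R : realType} (disp : measure_display)
    (T : measurableType disp) (P : probability T R) (rate : R)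
    (X : R -> T -> nat) : Prop := {
  pp_measurable : forall t : R, 0 <= t -> measurable_fun [set: T] (X t) ;
  pp_start : forall w : T, X 0 w = 0%N ;
  pp_nondecreasing : forall (w : T) (s t : R),
    0 <= s -> s <= t -> (X s w <= X t w)%N ;
  pp_right_continuous : forall (w : T) (t : R),
    0 <= t -> \forall s \near t^'+, X s w = X t w ;
  pp_independent_increments : forall (n : nat) (t : nat -> R) (B : nat -> set nat),
    0 <= t 0%N -> (forall k : nat, t k <= t k.+1) ->
    P [set w | forall k : nat, (k < n)%N -> B k (X (t k.+1) w - X (t k) w)%N] =
    (\prod_(k < n) P [set w | B k (X (t k.+1) w - X (t k) w)%N])%E ;
  pp_poisson_increments : forall (s t : R) (B : set nat), 0 <= s -> s <= t ->
    P [set w | B (X t w - X s w)%N] = poisson_prob (rate * (t - s)) 0%N B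
}.

(* Full reset: any arrival during the cycle (0, tau] clears the demand d. *)
Definition residual_demand {R : realType} (T : Type) (tau d : R)
    (X : R -> T -> nat) (w : T) : R :=
  if (0 < X tau w)%N then 0 else d.

(* Main.v *)
Require Import Defs.
From HB Require Import structures.
From mathcomp Require Import all_boot all_order all_algebra.
From mathcomp Require Import all_classical all_reals all_analysis.
From mathcomp Require Import ring lra.
Set Implicit Arguments.
Unset Strict Implicit.
Unset Printing Implicit Defensive.
Import Order.TTheory GRing.Theory Num.Theory.
Import numFieldNormedType.Exports.
Local Open Scope classical_set_scope.
Local Open Scope ring_scope.

(** The map [y * exp y] expands distances on the nonnegative half-line, so
    its inverse [lambertW] is increasing and 1-Lipschitz there. At
    [lam = lambertW (d piA tau^2 / psi) / tau] the first-order condition of the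
    payoff holds, and bounding [exp] below by its tangent gives
    [payoff mu <= payoff lam - psi/2 (lam - mu)^2]: this is existence and
    uniqueness of the maximizer at once. Demand then equals the sum of the
    [d exp (- lambertW (c piA))], whose properties follow termwise, and the
    fixed point comes from the intermediate value theorem on
    [[0, phi D_A(0)]]. *)

(** * The Lambert function on the nonnegative half-line *)

Section LambertW.
Context {R : realType}.
Implicit Types x y : R.

(** The difference of the two values is [(y - x) * expR y + x * (expR y - expR x)], where [expR y]
    is at least 1 and the second term is nonnegative. *)
Lemma mulr_expR_expansive x y : 0 <= x -> x <= y ->
  y - x <= y * expR y - x * expR x.
Proof.
move=> x0 xy.
have := expR_ge1Dx y; have : expR x <= expR y by rewrite ler_expR.
by nra.
Qed.

Lemma mulr_expR_surj :
  set_surj [set y : R | 0 <= y] [set x : R | 0 <= x] (fun y => y * expR y).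
Proof.
(* Expansion from 0 gives [x <= x * expR x], so [[0, x]] already contains a preimage of [x]. *)
move=> x /= x0; have x1 := mulr_expR_expansive (lexx 0) x0.
have [||c c0x <-] := @IVT R (fun y => y * expR y) 0 x x x0.
- apply: continuous_subspaceT => y.
  by apply: cvgM; [exact: cvg_id|exact: continuous_expR].
- by rewrite mul0r min_l ?max_r//; lra.
- by exists c => //=; move: c0x; rewrite in_itv/= => /andP[].
Qed.

Lemma lambertW_ge0 x : 0 <= x -> 0 <= lambertW x.
Proof. by move=> x0; apply: (surjpinv_image_sub mulr_expR_surj); exists x. Qed.

Lemma lambertW_expR x : 0 <= x -> lambertW x * expR (lambertW x) = x.
Proof. by move=> x0; apply: (surjpK _ mulr_expR_surj); rewrite inE. Qed.

Lemma lambertW_le x y : 0 <= x -> x <= y -> lambertW x <= lambertW y.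
Proof.
move=> x0 xy; rewrite leNgt; apply/negP => yx.
have y0 := le_trans x0 xy.
have := mulr_expR_expansive (lambertW_ge0 y0) (ltW yx).
by rewrite !lambertW_expR//; lra.
Qed.

Lemma lambertW_lt x y : 0 <= x -> x < y -> lambertW x < lambertW y.
Proof.
move=> x0 xy; rewrite lt_neqAle lambertW_le ?(ltW xy)// andbT.
apply/eqP => Wxy; have := lambertW_expR x0.
rewrite Wxy lambertW_expR ?(le_trans x0 (ltW xy))// => yx.
by rewrite yx ltxx in xy.
Qed.

Lemma lambertW_lipschitz x y : 0 <= x -> x <= y ->
  lambertW y - lambertW x <= y - x.
Proof.
move=> x0 xy; have y0 := le_trans x0 xy.
have := mulr_expR_expansive (lambertW_ge0 x0) (lambertW_le x0 xy).
by rewrite !lambertW_expR.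
Qed.

(** [y] and [lambertW (y * expR y)] have the same image, so expansion, applied in whichever order
    they stand, leaves no distance between them. *)
Lemma lambertWK y : 0 <= y -> lambertW (y * expR y) = y.
Proof.
move=> y0; have z0 : 0 <= y * expR y by rewrite mulr_ge0 ?expR_ge0.
have Wz := lambertW_expR z0; have Wz0 := lambertW_ge0 z0.
have [yz|zy] := leP y (lambertW (y * expR y)).
  by have := mulr_expR_expansive y0 yz; lra.
by have := mulr_expR_expansive Wz0 (ltW zy); lra.
Qed.

Lemma lambertW0 : lambertW (0 : R) = 0.
Proof. by rewrite -[X in lambertW X](mul0r (expR 0)) lambertWK. Qed.

(** Truncation at 0 gives a function continuous on the whole line: both [Num.max 0] and [lambertW]
    are 1-Lipschitz where used, so the tolerance [e] serves as its own modulus. *)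
Lemma continuous_lambertW_max0 : continuous (fun x => lambertW (Num.max 0 x)).
Proof.
move=> x; apply/cvgrPdist_le => e e0; near=> y.
have : `|x - y| <= e by near: y; exact: cvgr_dist_le.
have [mx my] : 0 <= Num.max 0 x /\ 0 <= Num.max 0 y by rewrite !le_max lexx.
apply: le_trans.
suff: `|lambertW (Num.max 0 x) - lambertW (Num.max 0 y)|
      <= `|Num.max 0 x - Num.max 0 y|.
  move=> /le_trans; apply; rewrite ler_norml.
  have := ler_norm (x - y); have := ler_norm (y - x); rewrite (distrC y).
  by case: (leP 0 x); case: (leP 0 y); lra.
have [xy|yx] := leP (Num.max 0 x) (Num.max 0 y).
  rewrite !ler0_norm ?subr_le0 ?lambertW_le// !opprB.
  exact: lambertW_lipschitz.
rewrite !ger0_norm ?subr_ge0 ?lambertW_le// ?(ltW yx)//.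
exact: lambertW_lipschitz (ltW yx).
Unshelve. all: by end_near. Qed.

Lemma lambertW_cvgy : lambertW x @[x --> (+oo : set_system R)] --> +oo.
Proof.
(* [lambertW] exceeds [B] beyond [B * expR B]; the maximum with 0 puts [B] where [lambertWK]
   applies. *)
apply/cvgryPge => A; pose B := Num.max 0 A.
have B0 : 0 <= B by rewrite le_max lexx.
near=> x; have Bx : B * expR B <= x.
  by near: x; apply: nbhs_pinfty_ge; exact: num_real.
apply: (@le_trans _ _ B); first by rewrite le_max lexx orbT.
by rewrite -{1}(lambertWK B0) lambertW_le// mulr_ge0 ?expR_ge0.
Unshelve. all: by end_near. Qed.

End LambertW.

(** * Existence, uniqueness and monotonicity of the optimal intensity *)

Section OptimalIntensity.
Context {R : realType}.
Implicit Types tau d psi piA lam mu : R.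

(* The concave revenue lies below its tangent at [lam], whose slope the
   first-order condition identifies as [psi * lam]. *)
Lemma access_payoff_gap tau d psi piA lam mu : 0 <= d * piA ->
  psi * lam = d * piA * tau * expR (- (lam * tau)) ->
  access_payoff tau d psi piA mu <=
  access_payoff tau d psi piA lam - psi / 2 * (lam - mu) ^+ 2.
Proof.
move=> dpi0 foc; rewrite /access_payoff.
have := expR_ge1Dx ((lam - mu) * tau).
have e0 : 0 <= d * piA * expR (- (lam * tau)) by rewrite mulr_ge0 ?expR_ge0.
move=> /(ler_wpM2l e0); rewrite -[leRHS]mulrA -expRD.
have -> : - (lam * tau) + (lam - mu) * tau = - (mu * tau) by ring.
have -> : d * piA * expR (- (lam * tau)) * (1 + (lam - mu) * tau) =
  d * piA * expR (- (lam * tau)) + (lam - mu) * (psi * lam).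
  by rewrite foc; ring.
(* The quadratic cost expands exactly around [lam]: its linear part cancels the tangent slope and
   its remainder is the square in the bound. *)
lra.
Qed.

Definition lambert_intensity tau d psi piA : R :=
  tau^-1 * lambertW (d * piA * tau ^+ 2 / psi).

Lemma lambert_arg_ge0 tau d psi piA : 0 <= d -> 0 < psi -> 0 <= piA ->
  0 <= d * piA * tau ^+ 2 / psi.
Proof.
move=> d0 psi0 pi0; rewrite divr_ge0 ?(ltW psi0)//.
by rewrite mulr_ge0 ?sqr_ge0 ?mulr_ge0.
Qed.

Lemma lambert_intensity_ge0 tau d psi piA :
  0 < tau -> 0 <= d -> 0 < psi -> 0 <= piA ->
  0 <= lambert_intensity tau d psi piA.
Proof.
move=> tau0 d0 psi0 pi0.
by rewrite mulr_ge0 ?invr_ge0 ?(ltW tau0)// lambertW_ge0 ?lambert_arg_ge0.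
Qed.

(** With [w] the Lambert value, [lam * tau = w], and [w * expR w] is the Lambert argument;
    multiplying by [expR (- w)] gives the condition. *)
Lemma lambert_intensity_foc tau d psi piA :
  0 < tau -> 0 <= d -> 0 < psi -> 0 <= piA ->
  psi * lambert_intensity tau d psi piA =
  d * piA * tau * expR (- (lambert_intensity tau d psi piA * tau)).
Proof.
move=> tau0 d0 psi0 pi0; rewrite /lambert_intensity.
have := lambertW_expR (lambert_arg_ge0 tau d0 psi0 pi0).
set w := lambertW _ => wE.
have -> : tau^-1 * w * tau = w by field; rewrite gt_eqF.
have -> : d * piA * tau = psi / tau * (w * expR w).
  by rewrite wE; field; rewrite !gt_eqF.
rewrite -!mulrA -expRD subrr expR0; ring.
Qed.

Lemma lambert_intensity_unique tau d psi piA :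
  0 < tau -> 0 <= d -> 0 < psi -> 0 <= piA ->
  unique (is_optimal_intensity tau d psi piA) (lambert_intensity tau d psi piA).
Proof.
move=> tau0 d0 psi0 pi0; have l0 := lambert_intensity_ge0 tau0 d0 psi0 pi0.
have gap mu := access_payoff_gap mu (mulr_ge0 d0 pi0)
  (lambert_intensity_foc tau0 d0 psi0 pi0).
set l := lambert_intensity _ _ _ _ in l0 gap *.
have sq0 mu : 0 <= psi / 2 * (l - mu) ^+ 2.
  by rewrite mulr_ge0 ?sqr_ge0 ?divr_ge0 ?(ltW psi0).
split; first by split=> // mu _; have := gap mu; have := sq0 mu; lra.
(* A rival maximizer [mu] pays at least as much as [l], so the quadratic gap must vanish. *)
move=> mu [mu0 /(_ l l0) lmu]; have /eqP : psi / 2 * (l - mu) ^+ 2 = 0.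
  by have := gap mu; have := sq0 mu; lra.
rewrite mulf_eq0 gt_eqF ?divr_gt0//= sqrf_eq0 subr_eq0.
by move/eqP.
Qed.

(** Existence rules out the default value of [get], and uniqueness determines its choice. *)
Lemma optimal_intensityE tau d psi piA :
  0 < tau -> 0 <= d -> 0 < psi -> 0 <= piA ->
  optimal_intensity tau d psi piA = lambert_intensity tau d psi piA.
Proof.
move=> tau0 d0 psi0 pi0.
have [opt uniq_opt] := lambert_intensity_unique tau0 d0 psi0 pi0.
by apply: get_unique => // mu /uniq_opt.
Qed.

Lemma optimal_intensity_ge0 tau d psi piA :
  0 < tau -> 0 <= d -> 0 < psi -> 0 <= piA ->
  0 <= optimal_intensity tau d psi piA.
Proof.
by move=> *; rewrite optimal_intensityE//; exact: lambert_intensity_ge0.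
Qed.

(** All three comparative statics at once, since the Lambert argument is monotone in each parameter;
    each single one follows by keeping the other two equal. *)
Lemma optimal_intensity_le tau d1 d2 psi1 psi2 pi1 pi2 : 0 < tau ->
  0 <= d1 -> d1 <= d2 -> 0 <= pi1 -> pi1 <= pi2 -> 0 < psi2 -> psi2 <= psi1 ->
  optimal_intensity tau d1 psi1 pi1 <= optimal_intensity tau d2 psi2 pi2.
Proof.
move=> tau0 d10 d12 p10 p12 q20 q21.
have q10 := lt_le_trans q20 q21; have d20 := le_trans d10 d12.
have p20 := le_trans p10 p12.
rewrite !optimal_intensityE// ler_wpM2l ?invr_ge0 ?(ltW tau0)//.
rewrite lambertW_le ?lambert_arg_ge0//.
apply: ler_pM.
- by rewrite mulr_ge0 ?sqr_ge0 ?mulr_ge0.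
- by rewrite invr_ge0 ltW.
- by rewrite ler_wpM2r ?sqr_ge0// ler_pM.
- by rewrite lef_pV2.
Qed.

End OptimalIntensity.

(** * Expected residual demand under Poisson arrivals *)

Section ResidualDemand.
Local Open Scope ereal_scope.

Lemma poisson_prob0 (R : realType) (rate : R) (k : nat) : (0 <= rate)%R ->
  poisson_prob rate k [set 0%N] = (expR (- rate))%:E.
Proof.
rewrite le_eqVlt /poisson_prob => /predU1P[<-|rate0].
  by rewrite ltxx oppr0 expR0 diracE mem_set.
rewrite rate0 esum_set1 ?lee_fin ?poisson_pmf_ge0//.
by rewrite /poisson_pmf rate0 expr0 fact0 invr1 !mul1r.
Qed.

(** Residual demand is [d] times the indicator of no arrival up to [tau], an event whose probability
    is the Poisson mass at 0. *)
Lemma expectation_residual_demand (R : realType) (disp : measure_display)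
    (T : measurableType disp) (P : probability T R) (rate tau d : R)
    (X : R -> T -> nat) : (0 <= tau)%R -> (0 <= rate)%R -> (0 <= d)%R ->
  poisson_process P rate X ->
  'E_P[residual_demand tau d X] = (d * expR (- (rate * tau)))%:E.
Proof.
move=> tau0 rate0 d0 PX; pose A := [set w | X tau w = 0%N].
have mA : measurable A.
  have := pp_measurable PX tau0 measurableT (Y := [set 0%N]) I.
  by rewrite setTI.
have PA : P A = (expR (- (rate * tau)))%:E.
  have := pp_poisson_increments PX [set 0%N] (lexx 0%R) tau0.
  rewrite subr0 poisson_prob0 ?mulr_ge0// => <-; congr (P _).
  (* The process starts at 0, so the count at [tau] is the increment over the whole cycle. *)
  by apply/seteqP; split=> w /=; rewrite (pp_start PX) subn0.
have resE w : residual_demand tau d X w = (d * \1_A w)%R.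
  rewrite /residual_demand indicE lt0n; case: (eqVneq (X tau w) 0%N) => Xw /=.
    by rewrite mem_set// mulr1.
  by rewrite memNset ?mulr0//; exact/eqP.
rewrite unlock; under eq_integral do rewrite resE EFinM.
rewrite ge0_integralZl_EFin//; last exact/measurable_realfun.measurable_EFinP.
by rewrite integral_indic// setIT EFinM -PA.
Qed.

End ResidualDemand.

(** * Aggregate demand as a function of the premium *)

Section AccessDemand.
Context {R : realType} (N : nat) (tau : R) (d psi : 'I_N -> R)
  (tau_gt0 : 0 < tau) (d_ge0 : forall i, 0 <= d i)
  (psi_gt0 : forall i, 0 < psi i).
Implicit Types piA : R.

Lemma access_demandE piA : 0 <= piA -> access_demand tau d psi piA =
  \sum_(i < N) d i * expR (- lambertW (d i * piA * tau ^+ 2 / psi i)).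
Proof.
move=> pi0; apply: eq_bigr => i _; rewrite optimal_intensityE//.
by rewrite /lambert_intensity mulrAC mulVf ?gt_eqF// mul1r.
Qed.

Lemma access_demand0 : access_demand tau d psi 0 = \sum_(i < N) d i.
Proof.
rewrite access_demandE//; apply: eq_bigr => i _.
by rewrite mulr0 !mul0r lambertW0 oppr0 expR0 mulr1.
Qed.

(** Every term is weakly decreasing; a positive total supplies an index with [0 < d i], whose term
    decreases strictly. *)
Lemma access_demand_lt pi1 pi2 : 0 < \sum_(i < N) d i ->
  0 <= pi1 -> pi1 < pi2 ->
  access_demand tau d psi pi2 < access_demand tau d psi pi1.
Proof.
move=> sd0 p10 p12; have p20 := ltW (le_lt_trans p10 p12).
rewrite !access_demandE//.
have [i di_gt0] : exists i, 0 < d i.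
  apply/not_existsP => d_le0; move: sd0; rewrite ltNge => /negP; apply.
  by apply: sumr_le0 => i _; rewrite leNgt; apply/negP.
have argE j x : d j * x * tau ^+ 2 / psi j = d j * tau ^+ 2 / psi j * x.
  by ring.
have c_gt0 : 0 < d i * tau ^+ 2 / psi i.
  by rewrite divr_gt0// mulr_gt0// exprn_gt0.
have term_le j : d j * expR (- lambertW (d j * pi2 * tau ^+ 2 / psi j)) <=
    d j * expR (- lambertW (d j * pi1 * tau ^+ 2 / psi j)).
  rewrite ler_wpM2l// ler_expR lerN2 lambertW_le ?lambert_arg_ge0//.
  by rewrite !argE ler_wpM2l ?(ltW p12)// divr_ge0 ?(ltW (psi_gt0 j))//
    mulr_ge0 ?sqr_ge0.
rewrite (bigD1 i)//= [ltRHS](bigD1 i)//= ltr_leD ?ler_sum//.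
rewrite ltr_pM2l// ltr_expR ltrN2 lambertW_lt ?lambert_arg_ge0//.
by rewrite !argE ltr_pM2l.
Qed.

Lemma continuous_access_demand_max0 :
  continuous (fun piA => access_demand tau d psi (Num.max 0 piA)).
Proof.
have max0 piA : 0 <= Num.max 0 piA by rewrite le_max lexx.
rewrite (_ : (fun _ => _) = fun piA => \sum_(i < N) d i *
    expR (- lambertW (Num.max 0 (d i * tau ^+ 2 / psi i * piA)))); last first.
  apply/funext => piA; rewrite access_demandE//; apply: eq_bigr => i _.
  have c0 : 0 <= d i * tau ^+ 2 / psi i.
    by rewrite divr_ge0 ?(ltW (psi_gt0 i))// mulr_ge0 ?sqr_ge0.
  (* The nonnegative coefficient passes through the maximum, so each term becomes a composition with
     the truncated Lambert function. *)
  rewrite -[0 in RHS](mulr0 (d i * tau ^+ 2 / psi i)) -maxr_pMr//.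
  by do 4 congr (_ _); ring.
apply: continuous_big => [x|i _ piA]; first exact: add_continuous.
apply: cvgMl_tmp.
apply: (cvg_comp (fun x => - lambertW (Num.max 0 (d i * tau ^+ 2 / psi i * x)))
  expR _ (@continuous_expR R _)).
apply: cvgN.
apply: (cvg_comp (fun x => d i * tau ^+ 2 / psi i * x)
  (fun x => lambertW (Num.max 0 x)) _ (@continuous_lambertW_max0 R _)).
by apply: cvgMl_tmp; exact: cvg_id.
Qed.

Lemma continuous_access_demand :
  {within [set x : R | 0 <= x], continuous (access_demand tau d psi)}.
Proof.
apply: (@subspace_eq_continuous _ _ _
  (fun piA => access_demand tau d psi (Num.max 0 piA))); last first.
  exact/continuous_subspaceT/continuous_access_demand_max0.
by move=> x; rewrite inE/= => x0; rewrite max_r.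
Qed.

Lemma access_demand_cvg0 :
  access_demand tau d psi piA @[piA --> (+oo : set_system R)] --> (0 : R).
Proof.
have -> : (0 : R) = \sum_(i < N) 0 by rewrite big1.
pose D piA :=
  \sum_(i < N) d i * expR (- lambertW (d i * tau ^+ 2 / psi i * piA)).
(* The closed form is available for [0 <= piA], which holds eventually. *)
apply: (@cvg_trans _ (D piA @[piA --> +oo])).
  apply: near_eq_cvg; near=> piA; rewrite access_demandE.
    by apply: eq_bigr => i _; do 4 congr (_ _); ring.
  by near: piA; apply: nbhs_pinfty_ge; exact: num_real.
apply: cvg_big => [x|i _]; first exact: add_continuous.
(* For [d i = 0] the exponential does not decay, but the factor [d i] makes the term zero. *)
have [->|di_neq0] := eqVneq (d i) 0.
  by under eq_fun do rewrite mul0r; exact: cvg_cst.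
have c_gt0 : 0 < d i * tau ^+ 2 / psi i.
  by rewrite divr_gt0// mulr_gt0 ?exprn_gt0// lt_neqAle eq_sym di_neq0 d_ge0.
rewrite -(mulr0 (d i)); apply: cvgMl_tmp.
apply: (cvg_comp (fun x => lambertW (d i * tau ^+ 2 / psi i * x))
  (fun x => expR (- x)) _ (@cvgr_expR R)).
apply: (cvg_comp (fun x => d i * tau ^+ 2 / psi i * x) lambertW _
  lambertW_cvgy).
by apply: gt0_cvgMry c_gt0 _; exact: cvg_id.
Unshelve. all: by end_near. Qed.

End AccessDemand.

(** * Fixed point of a strictly decreasing function *)

Lemma decreasing_fixed_point (R : realType) (f : R -> R) :
  {within [set x : R | 0 <= x], continuous f} ->
  (forall x y, 0 <= x -> x < y -> f y < f x) -> 0 < f 0 ->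
  exists! x, 0 < x /\ x = f x.
Proof.
move=> cf f_lt f0; pose g x := x - f x.
have cg : {within `[0, f 0], continuous g}.
  apply: (@continuous_subspaceW _ _ _ [set x : R | 0 <= x]).
    by move=> x /=; rewrite in_itv/= => /andP[].
  have cid : {within [set x : R | 0 <= x], continuous (@idfun R)}.
    by apply: continuous_subspaceT => y; exact: cvg_id.
  by move=> x; apply: cvgB; [exact: cid|exact: cf].
(* [f (f 0) < f 0] makes [g] positive at the right end [f 0], while [g 0 = - f 0] is negative. *)
have ff0 := f_lt _ _ (lexx 0) f0.
have [|x x0f /eqP] := IVT (ltW f0) cg (v := 0).
  by rewrite /g min_l ?max_r; lra.
rewrite subr_eq0 => /eqP xf; move: x0f; rewrite in_itv/= => /andP[x0 _].
exists x; split.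
  split=> //; rewrite lt_neqAle x0 andbT; apply/eqP => x_eq0.
  by move: f0; rewrite [f 0](_ : _ = 0) ?ltxx// x_eq0 -xf.
(* Of two distinct fixed points, [f] would reverse the order, yet it fixes both. *)
move=> y [y0 yf]; apply/eqP; rewrite eq_le !leNgt.
apply/andP; split; apply/negP => xy.
  by have := f_lt _ _ (ltW y0) xy; lra.
by have := f_lt _ _ x0 xy; lra.
Qed.

Theorem proposition1 (R : realType) (N : nat) (tau : R) (d psi : 'I_N -> R)
    (tau_gt0 : 0 < tau) (d_ge0 : forall i, 0 <= d i)
    (psi_gt0 : forall i, 0 < psi i) :
  (forall (piA : R) (i : 'I_N), 0 <= piA ->
     unique (is_optimal_intensity tau (d i) (psi i) piA)
       (tau^-1 * lambertW (d i * piA * tau ^+ 2 / psi i)) /\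
     optimal_intensity tau (d i) (psi i) piA =
       tau^-1 * lambertW (d i * piA * tau ^+ 2 / psi i)) /\
  (forall d1 d2 p piA : R, 0 <= d1 -> d1 <= d2 -> 0 < p -> 0 <= piA ->
     optimal_intensity tau d1 p piA <= optimal_intensity tau d2 p piA) /\
  (forall e p pi1 pi2 : R, 0 <= e -> 0 < p -> 0 <= pi1 -> pi1 <= pi2 ->
     optimal_intensity tau e p pi1 <= optimal_intensity tau e p pi2) /\
  (forall e p1 p2 piA : R, 0 <= e -> 0 < p1 -> p1 <= p2 -> 0 <= piA ->
     optimal_intensity tau e p2 piA <= optimal_intensity tau e p1 piA) /\
  (forall (piA : R) (disp : measure_display) (T : measurableType disp)
     (P : probability T R) (X : 'I_N -> R -> T -> nat), 0 <= piA ->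
     (forall i, poisson_process P
                  (optimal_intensity tau (d i) (psi i) piA) (X i)) ->
     (\sum_(i < N) 'E_P[residual_demand tau (d i) (X i)])%E =
     (access_demand tau d psi piA)%:E) /\
  (forall phi : R, 0 < phi -> 0 < \sum_(i < N) d i ->
     {within [set x : R | 0 <= x],
        continuous (fun piA : R => phi * access_demand tau d psi piA)} /\
     (forall pi1 pi2 : R, 0 <= pi1 -> pi1 < pi2 ->
        phi * access_demand tau d psi pi2 < phi * access_demand tau d psi pi1) /\
     phi * access_demand tau d psi 0 = phi * \sum_(i < N) d i /\
     0 < phi * \sum_(i < N) d i /\
     phi * access_demand tau d psi piA @[piA --> +oo] --> 0 /\
     exists! piA : R, 0 < piA /\ piA = phi * access_demand tau d psi piA).

Proof.
split.
  move=> piA i pi0.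
  by split; [exact: lambert_intensity_unique|exact: optimal_intensityE].
split; first by move=> *; exact: optimal_intensity_le.
split; first by move=> *; exact: optimal_intensity_le.
split; first by move=> *; exact: optimal_intensity_le.
split.
  move=> piA disp T P X pi0 PX; rewrite /access_demand -sumEFin.
  apply: eq_bigr => i _; apply: expectation_residual_demand (PX i) => //.
    exact: ltW.
  exact: optimal_intensity_ge0.
move=> phi phi0 sd0.
have cD : {within [set x : R | 0 <= x],
    continuous (fun piA : R => phi * access_demand tau d psi piA)}.
  by move=> x; apply: cvgMl_tmp; exact: continuous_access_demand.
have D_lt pi1 pi2 : 0 <= pi1 -> pi1 < pi2 ->
    phi * access_demand tau d psi pi2 < phi * access_demand tau d psi pi1.
  by move=> p10 p12; rewrite ltr_pM2l// access_demand_lt.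
have D0 : phi * access_demand tau d psi 0 = phi * \sum_(i < N) d i.
  by rewrite access_demand0.
split=> //; split=> //; split=> //; split; first exact: mulr_gt0.
split; last by apply: decreasing_fixed_point => //; rewrite D0 mulr_gt0.
rewrite -[X in _ --> X](mulr0 phi); apply: cvgMl_tmp.
exact: access_demand_cvg0.
Qed.
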